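(* For $j=1,\dots,m$, let $\{\kappa_{jn}\}_{n\ge1}$, $\{\iota_{jn}\}_{n\ge1}$, $\{\alpha_{jn}\}_{n\ge1}$, $\{\beta_{jn}\}_{n\ge1}$, $\{\varrho_{jn}\}_{n\ge1}$ be sequences of random matrices such that, as $n\to\infty$, $\kappa_{jn}\to\kappa_j$, $\iota_{jn}\to\iota_j$, $\alpha_{jn}\to\alpha_j$, $\beta_{jn}\to\beta_j$ and $\varrho_{jn}\to\varrho_j$ in probability, where $\kappa_j,\alpha_j$ are nonrandom $p\times p$ matrices, $\iota_j,\beta_j$ are nonrandom $q\times q$ matrices and $\varrho_j$ are nonrandom $p\times q$ matrices. Let $\{Y_n\}_{n\ge1}$ be a sequence of $p\times q$ random matrices such that $Y_n\to Y\sim\mathcal N_{p\times q}(0,\Lambda)$ in distribution, where $\Lambda$ is a $pq\times pq$ matrix. Then $$\begin{pmatrix}\kappa_{1n}Y_n\iota_{1n}+\alpha_{1n}Y_n\beta_{1n}+\varrho_{1n}\\ \kappa_{2n}Y_n\iota_{2n}+\alpha_{2n}Y_n\beta_{2n}+\varrho_{2n}\\ \vdots\\ \kappa_{mn}Y_n\iota_{mn}+\alpha_{mn}Y_n\beta_{mn}+\varrho_{mn}\end{pmatrix}\xrightarrow[n\to\infty]{d}U\sim\mathcal N_{mp\times q}(\varrho,A),$$ where $\varrho=(\varrho_1',\varrho_2',\dots,\varrho_m')'$ and $A=(A_{ij})_{i,j=1,\dots,m}$ is the block matrix with $pq\times pq$ blocks $$A_{ij}=(\kappa_i\otimes\iot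a_i')\Lambda(\kappa_j'\otimes\iota_j)+(\kappa_i\otimes\iota_i')\Lambda(\alpha_j'\otimes\beta_j)+(\alpha_i\otimes\beta_i')\Lambda(\kappa_j'\otimes\iota_j)+(\alpha_i\otimes\beta_i')\Lambda(\alpha_j'\otimes\beta_j).$$
   Context: Here $'$ is transpose and $\otimes$ the Kronecker product. For a matrix $A$, $\operatorname{vec}(A)$ denotes the column vector obtained by stacking the rows of $A$ (so $\operatorname{vec}(AYC)=(A\otimes C')\operatorname{vec}(Y)$). A random $a\times b$ matrix $Y$ is $\mathcal N_{a\times b}(\mu,\Omega)$ if $\operatorname{vec}(Y)$ is (possibly degenerate) $ab$-variate normal with mean $\operatorname{vec}(\mu)$ and covariance matrix $\Omega$ (symmetric nonnegative definite). For each $n$, all the random matrices with index $n$ are defined on a common probability space, and the random matrices have the same dimensions as their limits. *)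

(* Defs.v *)
From HB Require Import structures.
From mathcomp Require Export all_boot all_order all_algebra.
From mathcomp Require Export all_classical all_reals all_analysis.
From mathcomp.real_closed Require Export mxtens.
Export Order.TTheory GRing.Theory Num.Theory.
Export numFieldNormedType.Exports.

Set Implicit Arguments.
Unset Strict Implicit.
Unset Printing Implicit Defensive.

#[global] Open Scope classical_set_scope.
#[global] Open Scope ring_scope.

(* [mxvec] is row-major, so this is the column obtained by stacking the rows. *)
Definition vec (R : realType) (a b : nat) (A : 'M[R]_(a, b)) : 'cV[R]_(a * b) :=
  (mxvec A)^T.

Lemma index_allpairs_pair (A B : eqType) (s : seq A) (t : seq B) x y :
  x \in s -> y \in t ->
  index (x, y) [seq (a, b) | a <- s, b <- t] =
  (index x s * size t + index y t)%N.
Proof.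
move=> xs yt; elim: s xs => //= a s IH; rewrite inE index_cat size_map => /orP xs.
have [<-|nax] := eqVneq a x.
  rewrite mul0n add0n map_f // index_map // => u v; by case.
have -> : ((x, y) \in [seq (a, b) | b <- t]) = false.
  by apply/negP => /mapP[b _ [xa _]]; rewrite xa eqxx in nax.
rewrite IH ?mulSn ?addnA //.
by case: xs => // /eqP xa; rewrite xa eqxx in nax.
Qed.

(* [mxvec] and [*t] number the pairs (i, j) by two different definitions, which
   agree. *)
Lemma mxvec_indexE (a b : nat) (i : 'I_a) (j : 'I_b) :
  mxvec_index i j = mxtens_index (i, j).
Proof.
apply: val_inj => /=; rewrite /enum_rank [enum_rank_in]unlock insubdK; last first.
  by rewrite -topredE /= cardE index_mem mem_enum.
rewrite enumT unlock /= index_allpairs_pair ?mem_enum //.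
by rewrite !index_enum_ord size_enum_ord.
Qed.

Lemma vecE (R : realType) a b (A : 'M[R]_(a, b)) i j :
  vec A (mxtens_index (i, j)) 0 = A i j.
Proof. by rewrite mxE -mxvec_indexE mxvecE. Qed.

Lemma vec_mulmx (R : realType) a b c e (A : 'M[R]_(a, b)) (Y : 'M[R]_(b, c))
    (C : 'M[R]_(c, e)) :
  vec (A *m Y *m C) = (A *t C^T) *m vec Y.
Proof.
apply/matrixP => k z; rewrite ord1.
case: (mxtens_indexP k) => i j; rewrite vecE !mxE.
transitivity (\sum_(l : 'I_b * 'I_c) A i l.1 * C l.2 j * Y l.1 l.2).
  rewrite (eq_bigr (fun l => \sum_(r < b) A i r * C l j * Y r l)); last first.
    by move=> l _; rewrite mxE mulr_suml; apply: eq_bigr => r _; rewrite mulrAC.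
  by rewrite exchange_big pair_big.
rewrite (reindex (@mxtens_unindex b c)); last first.
  apply: onW_bij; exists (@mxtens_index b c);
    [exact: mxtens_unindexK | exact: mxtens_indexK].
apply: eq_bigr => l _; case: (mxtens_indexP l) => u v.
by rewrite mxtens_indexK tensmxE vecE /= [C^T _ _]mxE.
Qed.

(* Measurability for the Borel sigma-algebra of R^(a x b), which is the product
   of the Borel sigma-algebras of the coordinates. *)
Definition random_matrix (R : realType) (d : measure_display)
    (T : measurableType d) (a b : nat) (X : T -> 'M[R]_(a, b)) : Prop :=
  forall i j, measurable_fun [set: T] (fun t => X t i j).

(* The norm on matrices is the maximum of the absolute values of the entries. *)
Definition cvg_in_probability (R : realType) (d : nat -> measure_display)
    (T : forall n, measurableType (d n)) (P : forall n, probability (T n) R)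
    (a b : nat) (X : forall n, T n -> 'M[R]_(a, b)) (x : 'M[R]_(a, b)) : Prop :=
  forall e : R, 0 < e ->
    P n [set t | e < `|X n t - x|] @[n --> \oo] --> 0%E.

Definition cvg_in_distribution (R : realType) (d : nat -> measure_display)
    (T : forall n, measurableType (d n)) (P : forall n, probability (T n) R)
    (d' : measure_display) (T' : measurableType d') (P' : probability T' R)
    (a b : nat) (X : forall n, T n -> 'M[R]_(a, b)) (Y : T' -> 'M[R]_(a, b)) :
    Prop :=
  forall f : 'M[R]_(a, b) -> R, continuous f -> bounded_fun f ->
    ('E_(P n)[f \o X n] @[n --> \oo] --> 'E_P'[f \o Y])%E.

(* Normal law on R with mean mu and variance v. The case v = 0 is separate
   because [normal_prob mu 0] is the uniform law on [0, 1], not a point mass. *)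
Definition normal_law (R : realType) (mu v : R) (B : set R) : \bar R :=
  if v == 0 then \d_mu B else normal_prob mu (Num.sqrt v) B.

Definition nonneg_definite (R : realType) (k : nat) (S : 'M[R]_k) : Prop :=
  S^T = S /\ forall c : 'cV[R]_k, 0 <= (c^T *m S *m c) 0 0.

(* Possibly degenerate k-variate normal law with mean mu and covariance S: every
   linear combination c'X is normal on R, with mean c'mu and variance c'Sc. *)
Definition normal_vector (R : realType) (d : measure_display)
    (T : measurableType d) (P : probability T R) (k : nat)
    (X : T -> 'cV[R]_k) (mu : 'cV[R]_k) (S : 'M[R]_k) : Prop :=
  [/\ random_matrix X, nonneg_definite S &
      forall (c : 'cV[R]_k) (B : set R), measurable B ->
        P [set t | B ((c^T *m X t) 0 0)] =
        normal_law ((c^T *m mu) 0 0) ((c^T *m S *m c) 0 0) B].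

Definition normal_matrix (R : realType) (d : measure_display)
    (T : measurableType d) (P : probability T R) (a b : nat)
    (Y : T -> 'M[R]_(a, b)) (mu : 'M[R]_(a, b)) (Omega : 'M[R]_(a * b)) : Prop :=
  normal_vector P (fun t => vec (Y t)) (vec mu) Omega.

Lemma stack_vec_size (m p q : nat) :
  (\sum_(i < m) p * q = (\sum_(i < m) p) * q)%N.
Proof. by rewrite big_distrl. Qed.

Lemma vec_mxcol (R : realType) m p q (B : 'I_m -> 'M[R]_(p, q)) :
  vec (\mxcol_(j < m) B j) =
  castmx (stack_vec_size m p q, erefl) (\mxcol_(j < m) vec (B j)).
Proof.
apply/matrixP => k z; rewrite ord1 castmxE /= cast_ord_id.
case: (mxtens_indexP k) => s j; rewrite vecE.
rewrite -{1}[s]tagnat.sig2K.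
set r := tagnat.sig2 s; set b := tagnat.sig1 s.
have -> : cast_ord (esym (stack_vec_size m p q)) (mxtens_index (s, j)) =
          @tagnat.Rank m (fun=> (p * q)%N) b (mxtens_index (r, j)).
  apply: val_inj; rewrite /= -{1}[s]tagnat.sig2K tagnat.RankEsum.
  by rewrite [RHS]tagnat.RankEsum /= mulnDl big_distrl /= addnA.
have mxcolE n e (D : 'I_m -> 'M[R]_(n, e)) l (x : 'I_n) y :
    (\mxcol_(i < m) D i) (@tagnat.Rank m (fun=> n) l x) y = D l x y.
  have := congr1 (fun M : 'M[R]_(n, _) => M x y) (@mxcolK _ _ (fun=> n) _ D l).
  by rewrite mxE.
by rewrite !mxcolE vecE.
Qed.

(* Block matrix with m x m blocks of size pq x pq, as a matrix acting on the
   vec of an m-fold stack of p x q matrices. *)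
Definition stack_cov (R : realType) (m p q : nat)
    (A : 'I_m -> 'I_m -> 'M[R]_(p * q)) : 'M[R]_((\sum_(i < m) p) * q) :=
  castmx (stack_vec_size m p q, stack_vec_size m p q) (\mxblock_(i, j) A i j).

(* Main.v *)
Require Import Defs.
From mathcomp Require Import measurable_realfun ring lra.

(** Why the theorem holds. Write [g (c, y)] for the stack of the matrices
    [kappa_j y iota_j + alpha_j y beta_j + rho_j], where [c] collects all the
    coefficient matrices. The limit is [U = g (c, Y)], on the probability space
    of [Y], and two independent facts are needed.

    Normality. Vectorizing turns a product [K y I] into [(K *t I^T) (vec y)], so
    [vec U] is the image of [vec Y] under the affine map whose linear part [M]
    stacks the matrices [kappa_j *t iota_j^T + alpha_j *t beta_j^T] and whose
    constant part is [vec rho]. Affine maps preserve normality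
    ([normal_vector_affine]): a linear functional of the image is a linear
    functional of [vec Y] shifted by a constant, and a shift of a normal law is
    normal because Lebesgue measure is translation invariant. The covariance is
    [M Lambda M^T], whose blocks expand to the four products of the statement
    ([stack_covE]).

    Convergence. [g] is continuous, so this is a Slutsky theorem: if [C_n -> c]
    in probability and [Y_n -> Y] in distribution, then
    [g (C_n, Y_n) -> g (c, Y)] in distribution ([slutsky]). For bounded
    continuous [f], the function [y |-> f (g (c, y))] is bounded and continuous,
    so [E f (g (c, Y_n)) -> E f (g (c, Y))] by assumption. It remains to
    replace [c] by [C_n]. On a norm ball [|y| <= k + 1], which is compact,
    [f (g (w, y))] is within [e] of [f (g (c, y))] as soon as [w] lies in some
    neighbourhood of [c] that serves all such [y]. The event that [C_n] leaves
    this neighbourhood has probability tending to 0. The event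
    [|Y_n| > k + 1] is controlled by a continuous function [norm_excess k] that
    equals 1 on it and vanishes on the ball of radius [k]: its expectation
    under [Y_n] tends to its expectation under [Y], which is small for
    large [k].

    Convergence in probability is used in a form that speaks of neighbourhoods
    rather than norms ([nbhs_cvg_in_probability]), since this form passes
    at once to pairs and to finite families, so that all the coefficient
    matrices can be treated as a single random element. *)

Set Implicit Arguments.
Unset Strict Implicit.
Unset Printing Implicit Defensive.

(** * Translation of normal laws *)
Lemma lebesgue_measureD (R : realType) (s : R) (A : set R) : measurable A ->
  pushforward lebesgue_measure
    (+%R^~ s : measurableTypeR R -> measurableTypeR R) A = lebesgue_measure A.
Proof.
move=> mA; apply/esym/lebesgue_measure_unique => //=.
  exact: measurable_funD.
move=> _ _ [[a b]] _ <-.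
have shE : (+%R^~ s : R -> R) @^-1` `]a, b]%classic = `]a - s, b - s]%classic.
  by apply/seteqP; split => x /=; rewrite !in_itv/= ltrBlDr lerBrDr.
rewrite /pushforward shE !lebesgue_measure_itv/=.
rewrite !lte_fin ltrD2; case: ifP => // _; rewrite !EFinN -!EFinB; congr (_%:E).
ring.
Qed.

(** For [v != 0] the density of mean [m + s] at [x + s] is the density of mean
    [m] at [x], and Lebesgue measure is its own image under the shift. The
    hypothesis on [v] rules out a negative variance: its square root would be
    0, and then [normal_prob] is a uniform law that does not move with the
    mean. *)
Lemma normal_law_shift (R : realType) (m v s : R) (B : set R) : 0 <= v ->
  measurable B ->
  normal_law m v [set x | B (x + s)] = normal_law (m + s) v B.
Proof.
move=> v0 mB; rewrite /normal_law; case: eqP => [_|/eqP vn0].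
  by rewrite !diracE.
have sn0 : Num.sqrt v != 0 by rewrite sqrtr_eq0 -ltNge lt_neqAle eq_sym vn0.
rewrite /normal_prob.
have mS : measurable_fun [set: measurableTypeR R]
    (+%R^~ s : measurableTypeR R -> measurableTypeR R).
  exact: measurable_funD.
transitivity (\int[pushforward lebesgue_measure
   (+%R^~ s : measurableTypeR R -> measurableTypeR R)]_(x in B)
   (normal_pdf (m + s) (Num.sqrt v) x)%:E)%E; last first.
  by apply: eq_measure_integral => A mA _; exact: lebesgue_measureD.
rewrite ge0_integral_pushforward//=.
- apply: eq_integral => x _ /=; rewrite !normal_pdfE// /normal_fun.
  by rewrite opprD addrACA subrr addr0.
- apply/measurable_EFinP; exact: measurable_funS (measurable_normal_pdf _ _).
- by move=> x _; rewrite lee_fin normal_pdf_ge0.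
Qed.

(** * Measurability of random matrices *)

Lemma random_matrix_mulmx (R : realType) (d : measure_display)
    (T : measurableType d) a b c
    (X : T -> 'M[R]_(a, b)) (Y : T -> 'M[R]_(b, c)) :
  random_matrix X -> random_matrix Y -> random_matrix (fun t => X t *m Y t).
Proof.
move=> mX mY i j; under eq_fun do rewrite mxE.
by apply: measurable_sum => k; apply: measurable_funM.
Qed.

Lemma random_matrixD (R : realType) (d : measure_display)
    (T : measurableType d) a b (X Y : T -> 'M[R]_(a, b)) :
  random_matrix X -> random_matrix Y -> random_matrix (fun t => X t + Y t).
Proof.
by move=> mX mY i j; under eq_fun do rewrite mxE; apply: measurable_funD.
Qed.

Lemma random_matrix_cst (R : realType) (d : measure_display)
    (T : measurableType d) a b (A : 'M[R]_(a, b)) :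
  random_matrix (fun _ : T => A).
Proof. by move=> i j; exact: measurable_cst. Qed.

Lemma random_matrix_mxcol (R : realType) (d : measure_display)
    (T : measurableType d) m p q (X : 'I_m -> T -> 'M[R]_(p, q)) :
  (forall j, random_matrix (X j)) ->
  random_matrix (fun t => \mxcol_(j < m) X j t).
Proof. by move=> mX i j; under eq_fun do rewrite mxE; exact: mX. Qed.

(** * Affine images of normal vectors *)

(** The functional [c] of [M X + r] is the functional [M^T c] of [X], shifted
    by the number [c^T r]. *)
Lemma normal_vector_affine (R : realType) (d : measure_display)
    (T : measurableType d) (P : probability T R) (k l : nat)
    (X : T -> 'cV[R]_k) (mu : 'cV[R]_k) (S : 'M[R]_k)
    (M : 'M[R]_(l, k)) (r : 'cV[R]_l) :
  normal_vector P X mu S ->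
  normal_vector P (fun t => M *m X t + r) (M *m mu + r) (M *m S *m M^T).
Proof.
move=> [mX [St S0] nX].
have dual (c : 'cV[R]_l) (x : 'cV[R]_k) :
    (c^T *m (M *m x + r)) 0 0 = ((M^T *m c)^T *m x) 0 0 + (c^T *m r) 0 0.
  by rewrite mulmxDr mxE trmx_mul trmxK !mulmxA.
have quad (c : 'cV[R]_l) :
    c^T *m (M *m S *m M^T) *m c = (M^T *m c)^T *m S *m (M^T *m c).
  by rewrite trmx_mul trmxK !mulmxA.
split.
- apply: random_matrixD; last exact: random_matrix_cst.
  by apply: random_matrix_mulmx => //; exact: random_matrix_cst.
- split; first by rewrite !trmx_mul trmxK St mulmxA.
  by move=> c; rewrite quad; exact: S0.
- move=> c B mB; rewrite dual quad.
  rewrite -normal_law_shift// -nX; last first.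
    rewrite -[X in measurable X]setTI.
    have : measurable_fun setT (fun x : R => x + (c^T *m r) 0 0).
      exact: measurable_funD.
    exact.
  by congr (P _); apply/seteqP; split => t /=; rewrite dual.
Qed.

Section matrix_identities.
Variables (R : realType) (m p q : nat).
Implicit Types (L : 'I_m -> 'M[R]_(p * q)).

(** The cast reflects that the rows of a stack of [m] matrices of size
    [p * q] are numbered by a sum, those of a vectorized matrix by a
    product. *)
Definition stack_mx L : 'M[R]_((\sum_(i < m) p) * q, p * q) :=
  castmx (stack_vec_size m p q, erefl) (\mxcol_(j < m) L j).

Lemma vecD a b (A B : 'M[R]_(a, b)) : vec (A + B) = vec A + vec B.
Proof. by rewrite /vec !linearD. Qed.

Lemma vec_stack L (Y : 'M[R]_(p, q)) (Z : 'I_m -> 'M[R]_(p, q)) :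
  (forall j, vec (Z j) = L j *m vec Y) ->
  vec (\mxcol_(j < m) Z j) = stack_mx L *m vec Y.
Proof.
move=> ZL; rewrite vec_mxcol; under eq_mxcol do rewrite ZL.
by rewrite -mxcol_mul castmx_mul castmx_id.
Qed.

Lemma stack_covE L (S : 'M[R]_(p * q)) :
  stack_cov (fun i j => L i *m S *m (L j)^T) =
  stack_mx L *m S *m (stack_mx L)^T.
Proof.
rewrite /stack_cov /stack_mx -mul_mxcol_mxrow castmx_mul trmx_cast tr_mxcol.
by rewrite -mxcol_mul castmx_mul castmx_id.
Qed.

End matrix_identities.

(** * Continuous functions of random matrices *)

Lemma mx_norm_le (R : realType) a b (M : 'M[R]_(a, b)) (x : R) : 0 <= x ->
  `|M| <= x <-> forall i j, `|M i j| <= x.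
Proof.
move=> x0; rewrite [in X in X <-> _]/Num.norm /= mx_normrE; split.
  by move/bigmax_leP => [_ h] i j; exact: (h (i, j)).
by move=> h; apply/bigmax_leP; split => // -[i j] _; exact: h.
Qed.

(** Coordinatewise measurability suffices because the topology of the matrix
    space has a countable base of boxes with rational centre and radius: the
    preimage of an open set is a countable union of preimages of such boxes,
    and each of these is a finite intersection of measurable sets. *)
Lemma measurable_fun_continuous_random_matrix (R : realType)
    (d : measure_display) (T : measurableType d) a b
    (X : T -> 'M[R]_(a, b)) (f : 'M[R]_(a, b) -> R) :
  random_matrix X -> continuous f -> measurable_fun [set: T] (f \o X).
Proof.
move=> mX cf; apply: (measurability _ (RGenOInfty.measurableE R)).
move=> _ [_ [x ->] <-]; rewrite setTI.
pose box (c : 'M[rat]_(a, b) * rat) :=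
  [set N : 'M[R]_(a, b) | forall i j, `|N i j - ratr (c.1 i j)| < ratr c.2].
pose O := f @^-1` `]x, +oo[%classic.
have oO : open O by apply: open_comp => //; exact: interval_open.
have -> : (f \o X) @^-1` `]x, +oo[%classic =
    \bigcup_c (if c \in [set c | box c `<=` O] then X @^-1` box c else set0).
  rewrite -bigcup_mkcond; apply/seteqP; split => [t Ot|t [c cO ct]]; last first.
    exact: cO.
  have /nbhs_ballP[e /= e0 eO] : nbhs (X t) O by exact: open_nbhs_nbhs.
  have [r /itvP rin] := rat_in_itvoo (divr_gt0 e0 (ltr0n _ 2)).
  have r0 : 0 < ratr r :> R by rewrite rin.
  have re : ratr r < e / 2 by rewrite rin.
  (* The box is centred within [ratr r] of [X t] and has radius [ratr r], so it
     lies in the ball of radius [2 * ratr r < e] around [X t]. *)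
  have near_rat i j : {q : rat | `|X t i j - ratr q| < ratr r}.
    apply: cid; have [|q /itvP qin] :=
        @rat_in_itvoo R (X t i j - ratr r) (X t i j + ratr r).
      lra.
    exists q; rewrite ltr_distlC; apply/andP; split; by rewrite qin.
  exists (\matrix_(i, j) sval (near_rat i j), r) => /= [|i j]; last first.
    by rewrite mxE; case: (near_rat i j).
  move=> N NX; apply: eO; split => // i j; rewrite /ball/=.
  have := NX i j; rewrite /= mxE; case: (near_rat i j) => q /= Xq Nq.
  rewrite (le_lt_trans (ler_distD (ratr q) _ _))//.
  by rewrite (distrC (ratr q)); lra.
apply: countable_bigcupT_measurable => // c; case: ifP => // _.
have -> : X @^-1` box c = \bigcap_(k in [set: 'I_a * 'I_b])
    [set t | `|X t k.1 k.2 - ratr (c.1 k.1 k.2)| < ratr c.2].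
  by apply/seteqP; split => t /= h => [k _|i j]; [exact: h|exact: (h (i, j))].
apply: fin_bigcap_measurable => // -[i j] _ /=.
rewrite -[X in measurable X]setTI.
have : measurable_fun setT (fun t => `|X t i j - ratr (c.1 i j)|).
  apply: measurableT_comp => //; exact: measurable_funB.
move=> /(_ measurableT `]-oo, ratr c.2[%classic); rewrite set_itvNyo; apply.
by rewrite -set_itvNyo.
Qed.

(** The Heine-Borel property is transported from row vectors, where it is an
    instance of Tychonoff's theorem, along the continuous map [vec_mx]. *)
Lemma compact_mx_norm_le (R : realType) a b (x : R) :
  compact [set M : 'M[R]_(a, b) | `|M| <= x].
Proof.
have [x0|x0] := leP 0 x; last first.
  rewrite [X in compact X](_ : _ = set0); first exact: compact0.
  rewrite -subset0 => M /= Mx.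
  by move: (normr_ge0 M); rewrite leNgt (le_lt_trans Mx).
have -> : [set M : 'M[R]_(a, b) | `|M| <= x] =
    [set vec_mx v | v in [set v : 'rV[R]_(a * b) |
       forall i, (v ord0 i) \in `[- x, x]]].
  apply/seteqP; split => [M /= Mx|_ [v vx <-]].
    exists (mxvec M); last exact: mxvecK.
    case/mxvec_indexP => i j; rewrite mxvecE in_itv/= -ler_norml.
    by move/(mx_norm_le M x0): Mx; exact.
  apply/mx_norm_le => // i j; rewrite mxE ler_norml.
  by have := vx (mxvec_index i j); rewrite in_itv.
apply: continuous_compact.
  apply: continuous_subspaceT => v A /nbhs_ballP[e /= e0 eA].
  apply/nbhs_ballP; exists e => //= w [_ vw]; apply: eA; split => // i j.
  by rewrite !mxE; exact: vw.
apply: (@rV_compact _ _ (fun=> `[- x, x]%classic)).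
by move=> _; exact: segment_compact.
Qed.

(** * Truncation of large norms *)

(** A continuous substitute for the indicator of [k < |y|], so that its
    expectation passes to the limit under convergence in distribution. *)
Definition norm_excess (R : realType) a b (k : nat) (y : 'M[R]_(a, b)) : R :=
  Num.min 1 (Num.max 0 (`|y| - k%:R)).

Lemma norm_excess_ge0 (R : realType) a b k (y : 'M[R]_(a, b)) :
  0 <= norm_excess k y.
Proof. by rewrite /norm_excess le_min ler01 le_max lexx. Qed.

Lemma norm_excess_le1 (R : realType) a b k (y : 'M[R]_(a, b)) :
  norm_excess k y <= 1.
Proof. by rewrite /norm_excess ge_min lexx. Qed.

Lemma norm_excess_norm_le1 (R : realType) a b k (y : 'M[R]_(a, b)) :
  `|norm_excess k y| <= 1.
Proof. by rewrite ger0_norm ?norm_excess_ge0 ?norm_excess_le1. Qed.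

Lemma norm_excess1 (R : realType) a b k (y : 'M[R]_(a, b)) :
  k.+1%:R <= `|y| -> norm_excess k y = 1.
Proof.
move=> ky; apply/min_l; rewrite le_max lerBrDr -natr1 addrC in ky *.
by apply/orP; right.
Qed.

Lemma norm_excess0 (R : realType) a b k (y : 'M[R]_(a, b)) :
  `|y| <= k%:R -> norm_excess k y = 0.
Proof. by move=> ky; rewrite /norm_excess max_l ?subr_le0// min_r. Qed.

Lemma continuous_norm_excess (R : realType) a b k :
  continuous (@norm_excess R a b k).
Proof.
move=> y; apply: (@continuous_min R _ (cst 1)
  (fun z => Num.max 0 (`|z| - k%:R))).
  exact: cst_continuous.
apply: (@continuous_max R _ (cst 0) (fun z => `|z| - k%:R)).
  exact: cst_continuous.
apply: (@cvgB _ R^o _ (nbhs y)); [exact: norm_continuous|exact: cvg_cst].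
Qed.

(** * Expectations of bounded variables and tightness *)

Section bounded_expectation.
Variables (R : realType) (d : measure_display) (T : measurableType d).
Variable P : probability T R.
Implicit Types X Y Z : T -> R.

Lemma integrable_bounded_random X (M : R) :
  measurable_fun [set: T] X -> (forall t, `|X t| <= M) ->
  P.-integrable [set: T] (EFin \o X).
Proof.
move=> mX XM; apply: measurable_bounded_integrable => //.
  exact: (le_lt_trans (probability_le1 P measurableT) (ltry 1)).
exists M; split; first exact: num_real.
by move=> N MN t _; apply: (le_trans (XM t)); exact: ltW.
Qed.

Lemma expectation_Rintegral X (M : R) :
  measurable_fun [set: T] X -> (forall t, `|X t| <= M) ->
  'E_P[X]%E = (\int[P]_t X t)%:E.
Proof.
move=> mX XM; rewrite unlock /Rintegral fineK//.
apply: integrable_fin_num => //; exact: (integrable_bounded_random mX XM).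
Qed.

End bounded_expectation.

(** Bounded variables have finite expectations, so the convergence of the
    extended real expectations is that of real numbers, for which subtraction
    and linear arithmetic are available. *)
Lemma cvg_in_distribution_Rintegral (R : realType) (d : nat -> measure_display)
    (T : forall n, measurableType (d n)) (P : forall n, probability (T n) R)
    (d' : measure_display) (T' : measurableType d') (P' : probability T' R)
    (X : forall n, T n -> R) (Y : T' -> R) (M : R) :
  (forall n, measurable_fun [set: T n] (X n)) -> measurable_fun [set: T'] Y ->
  (forall n t, `|X n t| <= M) -> (forall t, `|Y t| <= M) ->
  ('E_(P n)[X n] @[n --> \oo] --> 'E_P'[Y])%E <->
  \int[P n]_t X n t @[n --> \oo] --> \int[P']_t Y t.
Proof.
move=> mX mY XM YM; rewrite (expectation_Rintegral _ mY YM).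
rewrite (_ : (fun n => _) = EFin \o (fun n => \int[P n]_t X n t)); last first.
  by apply/funext => n /=; rewrite (expectation_Rintegral _ (mX n) (XM n)).
split; first by move/fine_cvgP => [].
by move=> h; apply: cvg_EFin => //; near=> n.
Unshelve. all: by end_near. Qed.

(** Dominated convergence: for each outcome [t], the values vanish once [k]
    exceeds the norm of [Y t]. *)
Lemma norm_excess_tight (R : realType) (d : measure_display)
    (T : measurableType d) (P : probability T R) a b (Y : T -> 'M[R]_(a, b)) :
  random_matrix Y ->
  \int[P]_t norm_excess k (Y t) @[k --> \oo] --> 0.
Proof.
move=> mY.
have mE k : measurable_fun [set: T] (norm_excess k \o Y).
  apply: measurable_fun_continuous_random_matrix => //.
  exact: continuous_norm_excess.
have lim0 t : (norm_excess k (Y t))%:E @[k --> \oo] --> (0 : \bar R).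
  apply: cvg_near_cst; near=> k.
  rewrite norm_excess0//; apply: ltW; near: k; exact: nbhs_infty_gtr.
have [_ _] := @dominated_convergence _ _ _ P setT measurableT
  (fun k t => (norm_excess k (Y t))%:E) (cst 0%E) (cst 1%E)
  (fun k => proj2 (measurable_EFinP _ _) (mE k)) (measurable_cst _)
  (aeW _ (fun t _ => lim0 t)) (finite_measure_integrable_cst P 1 measurableT)
  (aeW _ (fun t k _ => norm_excess_norm_le1 k (Y t))).
rewrite integral0 => h; apply: fine_cvg; exact: h.
Unshelve. all: by end_near. Qed.

(** * Convergence in probability and Slutsky's theorem *)

Section in_probability.
Variables (R : realType) (d : nat -> measure_display).
Variables (T : forall n, measurableType (d n)).
Variables (P : forall n, probability (T n) R).

(** Convergence in probability to a constant in a space without a metric. The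
    event that [C n] leaves [A] is only required to be covered by a measurable
    event of small probability, so no sigma-algebra on [V] is involved. *)
Definition nbhs_cvg_in_probability (V : topologicalType)
    (C : forall n, T n -> V) (c : V) : Prop :=
  forall A, nbhs c A -> exists B : forall n, set (T n),
    [/\ forall n, measurable (B n), forall n t, ~ B n t -> A (C n t) &
        P n (B n) @[n --> \oo] --> 0%E].

Lemma cvg_probability_setU (B C : forall n, set (T n)) :
  (forall n, measurable (B n)) -> (forall n, measurable (C n)) ->
  P n (B n) @[n --> \oo] --> 0%E -> P n (C n) @[n --> \oo] --> 0%E ->
  P n (B n `|` C n) @[n --> \oo] --> 0%E.
Proof.
move=> mB mC B0 C0.
apply: (@squeeze_cvge _ _ _ _ (cst 0%E) _ (fun n => P n (B n) + P n (C n))%E).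
- by near=> n; rewrite measure_ge0 measureU2.
- exact: cvg_cst.
- by rewrite -[0%E]adde0; apply: cvgeD.
Unshelve. all: by end_near. Qed.

Lemma cvg_probability_bigsetU (I : Type) (s : seq I)
    (B : I -> forall n, set (T n)) :
  (forall i n, measurable (B i n)) ->
  (forall i, P n (B i n) @[n --> \oo] --> 0%E) ->
  P n (\big[setU/set0]_(i <- s) B i n) @[n --> \oo] --> 0%E.
Proof.
move=> mB B0; elim: s => [|i s IHs].
  by under eq_fun do rewrite big_nil measure0; exact: cvg_cst.
under eq_fun do rewrite big_cons.
apply: cvg_probability_setU => // n; exact: bigsetU_measurable.
Qed.

(** The exceptional event for a ball of radius [e] is taken with the threshold
    [e / 2], as the deviation must be strictly below [e] off that event. *)
Lemma cvg_in_probability_nbhs a b (X : forall n, T n -> 'M[R]_(a, b)) x :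
  (forall n, random_matrix (X n)) -> cvg_in_probability P X x ->
  nbhs_cvg_in_probability X x.
Proof.
move=> mX Xx A /nbhs_ballP[e /= e0 eA].
exists (fun n => [set t | e / 2 < `|X n t - x|]); split; last 1 first.
- by apply: Xx; rewrite divr_gt0.
- move=> n; rewrite -[X in measurable X]setTI.
  have : measurable_fun setT ((fun y => `|y - x|) \o X n).
    apply: measurable_fun_continuous_random_matrix => // y.
    apply: (@cvg_norm _ _ _ (nbhs y)).
    by apply: (@cvgB _ _ _ (nbhs y)); [exact: cvg_id|exact: cvg_cst].
  move=> /(_ measurableT `]e / 2, +oo[%classic); rewrite set_itvoy; apply.
  by rewrite -set_itvoy.
- move=> n t /= /negP; rewrite -leNgt => Xe; apply: eA.
  rewrite -ball_normE /ball_/= distrC (le_lt_trans Xe)//.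
  by rewrite ltr_pdivrMr// ltr_pMr// ltr1n.
Qed.

Lemma nbhs_cvg_in_probability_pair (V W : topologicalType)
    (C : forall n, T n -> V) (D : forall n, T n -> W) c e :
  nbhs_cvg_in_probability C c -> nbhs_cvg_in_probability D e ->
  nbhs_cvg_in_probability (fun n t => (C n t, D n t)) (c, e).
Proof.
move=> Cc De A [[A1 A2] /= [cA1 eA2] A12].
have [B1 [mB1 B1A B10]] := Cc _ cA1; have [B2 [mB2 B2A B20]] := De _ eA2.
exists (fun n => B1 n `|` B2 n); split; last exact: cvg_probability_setU.
  by move=> n; exact: measurableU.
by move=> n t /not_orP[? ?]; apply: A12; split; [exact: B1A|exact: B2A].
Qed.

(** A basic neighbourhood of a row is a product of neighbourhoods of its
    entries, so a finite union of exceptional events covers it. *)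
Lemma nbhs_cvg_in_probability_row (V : topologicalType) m
    (C : 'I_m -> forall n, T n -> V) (c : 'I_m -> V) :
  (forall j, nbhs_cvg_in_probability (C j) (c j)) ->
  nbhs_cvg_in_probability (fun n t => \row_j C j n t) (\row_j c j).
Proof.
move=> Cc A [Q /= cQ QA].
have {}cQ j : nbhs (c j) (Q 0 j) by have := cQ 0 j; rewrite mxE.
have /choice[B HB] := fun j => Cc j _ (cQ j).
exists (fun n => \big[setU/set0]_(j <- enum 'I_m) B j n); split.
- by move=> n; apply: bigsetU_measurable => j _; have [] := HB j.
- move=> n t nB; apply: QA => i j; rewrite ord1 mxE.
  have [_ + _] := HB j; apply.
  apply: contra_not nB => Bt; rewrite -bigcup_seq; exists j => //=.
  by rewrite mem_enum.
- by apply: cvg_probability_bigsetU => [j n|j]; have [] := HB j.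
Qed.

(** The expectations of [f (g (C n, Y_ n))] and [f (g (c, Y_ n))] are compared
    through a pointwise bound, with [M] a bound of [f]: the two variables differ
    by at most [e] when [C n] is close to [c] and [Y_ n] lies in a fixed compact
    ball, and by at most [2 * M] otherwise. *)
Theorem slutsky (V : topologicalType) a b a' b'
    (g : V * 'M[R]_(a, b) -> 'M[R]_(a', b'))
    (C : forall n, T n -> V) (c : V)
    (Y_ : forall n, T n -> 'M[R]_(a, b))
    (d' : measure_display) (T' : measurableType d') (P' : probability T' R)
    (Y : T' -> 'M[R]_(a, b)) :
  (forall y, {for (c, y), continuous g}) ->
  (forall n, random_matrix (Y_ n)) -> random_matrix Y ->
  (forall n, random_matrix (fun t => g (C n t, Y_ n t))) ->
  nbhs_cvg_in_probability C c -> cvg_in_distribution P P' Y_ Y ->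
  cvg_in_distribution P P' (fun n t => g (C n t, Y_ n t)) (fun t => g (c, Y t)).
Proof.
move=> cg mY_ mY mg Cc YY f cf bf.
have [M M0 fM] : exists2 M : R, 0 < M & forall z, `|f z| <= M.
  have [N [_ hN]] := bf; exists (Num.max 1 (N + 1)).
    by rewrite lt_max ltr01.
  by move=> z; apply: hN => //; rewrite lt_max ltrDl ltr01 orbT.
pose h (w : V) (y : 'M[R]_(a, b)) := f (g (w, y)).
have ch : continuous (h c).
  move=> y.
  apply: (@continuous_comp _ _ _ (fun y => g (c, y)) f); last exact: cf.
  apply: (@continuous_comp _ _ _ (fun y => (c, y)) g); last exact: cg.
  move=> A [[A1 A2] /= [cA1 yA2] A12]; apply: filterS yA2 => z A2z.
  by apply: A12; split => //; exact: nbhs_singleton.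
have mh n : measurable_fun [set: T n] (h c \o Y_ n).
  exact: measurable_fun_continuous_random_matrix.
have mhY : measurable_fun [set: T'] (h c \o Y).
  exact: measurable_fun_continuous_random_matrix.
have mf n : measurable_fun [set: T n] (fun t => h (C n t) (Y_ n t)).
  exact: (measurable_fun_continuous_random_matrix (mg n) cf).
apply/(cvg_in_distribution_Rintegral P P' mf mhY
  (fun n t => fM _) (fun t => fM _)).
have /(cvg_in_distribution_Rintegral P P' mh mhY
      (fun n t => fM _) (fun t => fM _)) cvg_h :
    ('E_(P n)[h c \o Y_ n] @[n --> \oo] --> 'E_P'[h c \o Y])%E.
  apply: YY => //; exists M; split; first exact: num_real.
  by move=> N MN y _; apply: (le_trans (fM _)); exact: ltW.
suff diff0 : \int[P n]_t h (C n t) (Y_ n t) - \int[P n]_t h c (Y_ n t)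
    @[n --> \oo] --> 0.
  have -> : (fun n => \int[P n]_t h (C n t) (Y_ n t)) =
      (fun n => \int[P n]_t h (C n t) (Y_ n t) - \int[P n]_t h c (Y_ n t) +
                \int[P n]_t h c (Y_ n t)) by apply/funext => n; rewrite subrK.
  by rewrite -[X in _ --> X]add0r; exact: cvgD.
have M4 : 0 < 1 + 4 * M by lra.
(* The pointwise bound integrates to [e + 2 * M * e + 2 * M * e], whence the
   choice of [e]. *)
apply/cvgr0Pnorm_le => e0 e0_gt0; pose e := e0 / (1 + 4 * M).
have e_gt0 : 0 < e by rewrite divr_gt0.
have [k Yk] : exists k, \int[P']_t norm_excess k (Y t) < e.
  have /cvgr0Pnorm_lt/(_ e e_gt0)[k _ hk] := norm_excess_tight P' mY.
  by exists k; rewrite (le_lt_trans (ler_norm _))// hk /=.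
have mX n : measurable_fun [set: T n] (norm_excess k \o Y_ n).
  apply: measurable_fun_continuous_random_matrix => //.
  exact: continuous_norm_excess.
have mXY : measurable_fun [set: T'] (norm_excess k \o Y).
  apply: measurable_fun_continuous_random_matrix => //.
  exact: continuous_norm_excess.
have tight : \int[P n]_t norm_excess k (Y_ n t) @[n --> \oo] -->
    \int[P']_t norm_excess k (Y t).
  have /(cvg_in_distribution_Rintegral P P' mX mXY
      (fun n t => norm_excess_norm_le1 _ _)
      (fun t => norm_excess_norm_le1 _ _)) :
      ('E_(P n)[norm_excess k \o Y_ n] @[n --> \oo] -->
      'E_P'[norm_excess k \o Y])%E.
    apply: YY; first exact: continuous_norm_excess.
    exists 1; split; first exact: num_real.
    move=> N N1 y _; apply: (le_trans (norm_excess_norm_le1 _ _)).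
    exact: ltW.
  exact.
pose K := [set y : 'M[R]_(a, b) | `|y| <= k.+1%:R].
(* Compactness of [K] makes the neighbourhood of [c] uniform in [y]. *)
have unif : \forall w \near c, K `<=` (fun y => `|h w y - h c y| < e).
  have /compact_near_coveringP := @compact_mx_norm_le R a b k.+1%:R.
  apply => y _.
  have cfg : {for (c, y), continuous (f \o g)}.
    by apply: continuous_comp; [exact: cg|exact: cf].
  have /cvgrPdist_lt/(_ (e / 2)) := cfg.
  case; first by rewrite divr_gt0.
  move=> [A1 A2] /= [cA1 yA2] A12; exists (A2, A1) => // -[y' w] /= [A2y' A1w].
  have wy' := A12 (w, y') (conj A1w A2y').
  have cy' := A12 (c, y') (conj (nbhs_singleton cA1) A2y').
  rewrite /h (le_lt_trans (ler_distD (f (g (c, y))) _ _))//.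
  by rewrite [ltRHS]splitr ltrD// distrC.
have [B [mB BA B0]] := Cc _ unif.
have Bfin n : P n (B n) \is a fin_num by exact: fin_num_measure.
have {}B0 : fine (P n (B n)) @[n --> \oo] --> 0 by exact: fine_cvg.
near=> n.
have Bn : fine (P n (B n)) <= e by near: n; exact: cvgr_le B0 _ e_gt0.
have Xn : \int[P n]_t norm_excess k (Y_ n t) <= e.
  by near: n; exact: cvgr_le tight _ Yk.
pose bound t : R := e + 2 * M * \1_(B n) t + 2 * M * norm_excess k (Y_ n t).
have dist_le t : `|h (C n t) (Y_ n t) - h c (Y_ n t)| <= bound t.
  have diam : `|h (C n t) (Y_ n t) - h c (Y_ n t)| <= 2 * M.
    by apply: (le_trans (ler_normB _ _)); rewrite mulr_natl mulr2n lerD ?fM.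
  have := norm_excess_ge0 k (Y_ n t); rewrite /bound indicE => X0.
  have MX : 0 <= 2 * M * norm_excess k (Y_ n t) by rewrite !mulr_ge0// ltW.
  have [Bt|nBt] := pselect (B n t).
    rewrite mem_set//=; lra.
  rewrite memNset//= mulr0 addr0.
  have [Yk1|Yk1] := leP `|Y_ n t| k.+1%:R.
    have := BA _ _ nBt _ Yk1; lra.
  rewrite norm_excess1 ?ltW//; lra.
have ih : (P n).-integrable [set: T n] (EFin \o (fun t => h (C n t) (Y_ n t))).
  exact: (integrable_bounded_random _ (mf n) (fun t => fM _)).
have ihc : (P n).-integrable [set: T n] (EFin \o (fun t => h c (Y_ n t))).
  exact: (integrable_bounded_random _ (mh n) (fun t => fM _)).
have iX : (P n).-integrable [set: T n]
    (EFin \o (fun t => norm_excess k (Y_ n t))).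
  exact: (integrable_bounded_random _ (mX n) (fun t => norm_excess_norm_le1 _ _)).
have i1 : (P n).-integrable [set: T n] (EFin \o (\1_(B n) : T n -> R)).
  apply: (@integrable_bounded_random _ _ _ (P n) _ 1) => // t.
  by rewrite indicE; case: (_ \in _); rewrite ?normr1 ?normr0.
have ie : (P n).-integrable [set: T n] (EFin \o (fun=> e)).
  by apply: (@integrable_bounded_random _ _ _ (P n) _ e) => // t; rewrite gtr0_norm.
have iZ r X : (P n).-integrable [set: T n] (EFin \o X) ->
    (P n).-integrable [set: T n] (EFin \o (fun t => r * X t)).
  by move=> iX'; exact: (integrableZl measurableT r iX').
have iD X X' : (P n).-integrable [set: T n] (EFin \o X) ->
    (P n).-integrable [set: T n] (EFin \o X') ->
    (P n).-integrable [set: T n] (EFin \o (fun t => X t + X' t)).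
  by move=> iX' iX''; exact: (integrableD measurableT iX' iX'').
have Ebound : \int[P n]_t bound t =
    e + 2 * M * fine (P n (B n)) + 2 * M * \int[P n]_t norm_excess k (Y_ n t).
  rewrite /bound RintegralD// ?RintegralD//;
    [|exact: iZ|exact: iD (iZ _ _ _)|exact: iZ].
  have -> : \int[P n]_(t in setT) e = e.
    rewrite /Rintegral integral_cst//.
    transitivity (fine (e%:E * 1)%E); last by rewrite mule1.
    by congr (fine (_ * _)%E); exact: probability_setT.
  have -> : \int[P n]_t (2 * M * \1_(B n) t) = 2 * M * fine (P n (B n)).
    by rewrite RintegralZl// /Rintegral integral_indic// setIT.
  by rewrite RintegralZl.
have ihB := integrableB measurableT ih ihc.
have ibound : (P n).-integrable [set: T n] (EFin \o bound).
  by apply: (iD _ _ _ (iZ _ _ iX)); exact: (iD _ _ ie (iZ _ _ i1)).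
rewrite -RintegralB// (le_trans (le_normr_Rintegral measurableT ihB))//.
have := le_Rintegral measurableT (integrable_norm ihB) ibound
  (fun t _ => dist_le t).
move=> /le_trans; apply.
rewrite Ebound; have e0E : e * (1 + 4 * M) = e0 by rewrite /e divfK// gt_eqF.
nra.
Unshelve. all: by end_near. Qed.
End in_probability.

(** * Continuity of the matrix operations *)

Section cvg_matrix.
Variables (R : realType) (I : Type) (F : set_system I).
Context {FF : Filter F}.

Lemma cvg_mx (V : topologicalType) a b
    (A : I -> 'M[V]_(a, b)) (L : 'M[V]_(a, b)) :
  (forall i j, A z i j @[z --> F] --> L i j) -> A z @[z --> F] --> L.
Proof.
move=> AL S [Q LQ QS].
have : \forall z \near F, forall i j, Q i j (A z i j).
  apply: filter_forall => i; apply: filter_forall => j.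
  exact: AL (LQ i j).
by apply: filterS => z Qz; exact: QS.
Qed.

Lemma cvg_mx_coord (V : topologicalType) a b
    (A : I -> 'M[V]_(a, b)) (L : 'M[V]_(a, b)) i j :
  A z @[z --> F] --> L -> A z i j @[z --> F] --> L i j.
Proof.
move=> AL S LS.
have : nbhs L [set M : 'M[V]_(a, b) | S (M i j)].
  exists (fun i' j' => [set x | (i', j') = (i, j) -> S x]) => /= [i' j'|M]; last first.
    exact.
  have [[-> ->]|ne] := eqVneq (i', j') (i, j).
    by apply: filterS LS => x Sx _.
  by apply: nearW => x /eqP; rewrite (negbTE ne).
exact: AL.
Qed.

Lemma cvg_mulmx a b c (A : I -> 'M[R]_(a, b)) (B : I -> 'M[R]_(b, c))
    (LA : 'M[R]_(a, b)) (LB : 'M[R]_(b, c)) :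
  A z @[z --> F] --> LA -> B z @[z --> F] --> LB ->
  A z *m B z @[z --> F] --> LA *m LB.
Proof.
move=> cA cB; apply: cvg_mx => i j; rewrite mxE; under eq_fun do rewrite mxE.
apply: cvg_big => [|k _]; first exact: (@add_continuous R^o).
by apply: (@cvgM R); exact: cvg_mx_coord.
Qed.

Lemma cvg_mxcol m a b (A : 'I_m -> I -> 'M[R]_(a, b))
    (L : 'I_m -> 'M[R]_(a, b)) :
  (forall j, A j z @[z --> F] --> L j) ->
  \mxcol_j A j z @[z --> F] --> \mxcol_j L j.
Proof.
move=> AL; apply: cvg_mx => i j; rewrite mxE; under eq_fun do rewrite mxE.
exact: cvg_mx_coord.
Qed.

End cvg_matrix.

(** * The limit of the stacked matrices *)

Lemma vec_bilinear_form (R : realType) p q (K A : 'M[R]_p) (I B : 'M[R]_q)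
    (Y : 'M[R]_(p, q)) :
  vec (K *m Y *m I + A *m Y *m B) = (K *t I^T + A *t B^T) *m vec Y.
Proof. by rewrite vecD !vec_mulmx mulmxDl. Qed.

Local Notation coefficients R p q :=
  ('M[R]_p * 'M[R]_q * 'M[R]_p * 'M[R]_q * 'M[R]_(p, q))%type.

Definition bilinear_affine (R : realType) p q (w : coefficients R p q)
    (y : 'M[R]_(p, q)) : 'M[R]_(p, q) :=
  w.1.1.1.1 *m y *m w.1.1.1.2 + w.1.1.2 *m y *m w.1.2 + w.2.

Definition stacked_bilinear_affine (R : realType) m p q
    (z : 'rV[coefficients R p q]_m * 'M[R]_(p, q)) :
  'M[R]_(\sum_(j < m) p, q) :=
  \mxcol_(j < m) bilinear_affine (z.1 0 j) z.2.

Lemma continuous_stacked_bilinear_affine (R : realType) m p q :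
  continuous (@stacked_bilinear_affine R m p q).
Proof.
move=> -[w y]; apply: cvg_mxcol => j.
have cy : z.2 @[z --> nbhs (w, y)] --> y by exact: cvg_snd.
have w1 : z.1 @[z --> nbhs (w, y)] --> w by exact: cvg_fst.
have cw := @cvg_mx_coord _ _ _ _ _ _ _ 0 j w1.
have fstC (V W : topologicalType) f (x : V * W) :
    f z @[z --> nbhs (w, y)] --> x ->
    (f z).1 @[z --> nbhs (w, y)] --> x.1.
  by move=> fx; apply: (cvg_comp _ _ fx); exact: cvg_fst.
have sndC (V W : topologicalType) f (x : V * W) :
    f z @[z --> nbhs (w, y)] --> x ->
    (f z).2 @[z --> nbhs (w, y)] --> x.2.
  by move=> fx; apply: (cvg_comp _ _ fx); exact: cvg_snd.
apply: cvgD; last exact: (@sndC _ _ _ _ cw).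
apply: cvgD; (apply: cvg_mulmx; first apply: cvg_mulmx) => //.
- by do 4!apply: (@fstC).
- by apply: (@sndC); do 3!apply: (@fstC).
- by apply: (@sndC); do 2!apply: (@fstC).
- by apply: (@sndC); apply: (@fstC).
Qed.

Theorem lemmaA2 (R : realType) (m p q : nat)
  (d : nat -> measure_display) (T : forall n, measurableType (d n))
  (P : forall n, probability (T n) R)
  (kappa_ alpha_ : 'I_m -> forall n, T n -> 'M[R]_p)
  (iota_ beta_ : 'I_m -> forall n, T n -> 'M[R]_q)
  (rho_ : 'I_m -> forall n, T n -> 'M[R]_(p, q))
  (kappa alpha : 'I_m -> 'M[R]_p)
  (iota beta : 'I_m -> 'M[R]_q)
  (rho : 'I_m -> 'M[R]_(p, q))
  (kappa_rm : forall j n, random_matrix (kappa_ j n))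
  (iota_rm : forall j n, random_matrix (iota_ j n))
  (alpha_rm : forall j n, random_matrix (alpha_ j n))
  (beta_rm : forall j n, random_matrix (beta_ j n))
  (rho_rm : forall j n, random_matrix (rho_ j n))
  (kappa_cvg : forall j, cvg_in_probability P (kappa_ j) (kappa j))
  (iota_cvg : forall j, cvg_in_probability P (iota_ j) (iota j))
  (alpha_cvg : forall j, cvg_in_probability P (alpha_ j) (alpha j))
  (beta_cvg : forall j, cvg_in_probability P (beta_ j) (beta j))
  (rho_cvg : forall j, cvg_in_probability P (rho_ j) (rho j))
  (Y_ : forall n, T n -> 'M[R]_(p, q))
  (Y_rm : forall n, random_matrix (Y_ n))
  (dY : measure_display) (TY : measurableType dY) (PY : probability TY R)
  (Y : TY -> 'M[R]_(p, q)) (Lambda : 'M[R]_(p * q))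
  (Y_normal : normal_matrix PY Y 0 Lambda)
  (Y_cvg : cvg_in_distribution P PY Y_ Y) :
  exists (dU : measure_display) (TU : measurableType dU)
      (PU : probability TU R) (U : TU -> 'M[R]_(\sum_(j < m) p, q)),
    normal_matrix PU U
      (\mxcol_(j < m) rho j)
      (stack_cov (fun i j =>
           (kappa i *t (iota i)^T) *m Lambda *m ((kappa j)^T *t iota j)
         + (kappa i *t (iota i)^T) *m Lambda *m ((alpha j)^T *t beta j)
         + (alpha i *t (beta i)^T) *m Lambda *m ((kappa j)^T *t iota j)
         + (alpha i *t (beta i)^T) *m Lambda *m ((alpha j)^T *t beta j))) /\
    cvg_in_distribution P PU
      (fun n t => \mxcol_(j < m)
         (kappa_ j n t *m Y_ n t *m iota_ j n t
          + alpha_ j n t *m Y_ n t *m beta_ j n t + rho_ j n t))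
      U.
Proof.
(* The linear part of [vec U] as a function of [vec Y], block by block. *)
pose L j := kappa j *t (iota j)^T + alpha j *t (beta j)^T.
pose g := @stacked_bilinear_affine R m p q.
pose c := \row_j (kappa j, iota j, alpha j, beta j, rho j).
pose C n t :=
  \row_j (kappa_ j n t, iota_ j n t, alpha_ j n t, beta_ j n t, rho_ j n t).
have gE n t : g (C n t, Y_ n t) = \mxcol_(j < m)
    (kappa_ j n t *m Y_ n t *m iota_ j n t
     + alpha_ j n t *m Y_ n t *m beta_ j n t + rho_ j n t).
  by apply: eq_mxcol => j; rewrite /bilinear_affine /= mxE.
have cgE y : g (c, y) = \mxcol_(j < m)
    (kappa j *m y *m iota j + alpha j *m y *m beta j + rho j).
  by apply: eq_mxcol => j; rewrite /bilinear_affine /= mxE.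
have mY : random_matrix Y.
  have [mvY _ _] := Y_normal => i j.
  by have := mvY (mxtens_index (i, j)) 0; under eq_fun do rewrite vecE.
exists dY, TY, PY, (fun t => g (c, Y t)); split.
  have vecU t : vec (g (c, Y t)) =
      stack_mx L *m vec (Y t) + vec (\mxcol_(j < m) rho j).
    rewrite cgE mxcolD vecD; congr (_ + _).
    by apply: vec_stack => j; exact: vec_bilinear_form.
  rewrite /normal_matrix (funext vecU).
  have := normal_vector_affine (stack_mx L) (vec (\mxcol_(j < m) rho j))
    Y_normal.
  have vec0 : vec (0 : 'M[R]_(p, q)) = 0 by rewrite /vec !linear0.
  rewrite -stack_covE vec0 mulmx0 add0r.
  congr (normal_vector _ _ _ (stack_cov _)).
  apply/funext => i; apply/funext => j.
  rewrite /L linearD/= !trmx_tens !trmxK.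
  by rewrite !mulmxDl !mulmxDr !addrA.
rewrite (_ : (fun n t => \mxcol_j _) = fun n t => g (C n t, Y_ n t)); last first.
  by apply: functional_extensionality_dep => n; apply/funext => t; rewrite gE.
apply: slutsky => //.
- by move=> y; exact: continuous_stacked_bilinear_affine.
- move=> n; rewrite (funext (gE n)).
  apply: random_matrix_mxcol => j; apply: random_matrixD => //.
  by apply: random_matrixD; do 2!apply: random_matrix_mulmx => //.
- apply: nbhs_cvg_in_probability_row => j.
  do 4!(apply: nbhs_cvg_in_probability_pair;
        last exact: cvg_in_probability_nbhs).
  exact: cvg_in_probability_nbhs.
Qed.
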